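(* Let $p$ be a prime and $N>3$ an integer prime to $p$. The action of the Hecke operator $T_p$ on modular forms of level $\Gamma_0(N)$ extends so that $$T_p(\log q)=\big(p^{-1}+p^{-2}\big)\log q .$$
   Context: Modular forms of level $\Gamma_0(N)$ are the elements of the graded ring $\mathrm{MF}(\Gamma_1(N))$ (modular forms of level $\Gamma_1(N)$ over $\mathbb Z[1/N]$ with no condition at the cusps) that have trivial Nebentypus character. Here $q=e^{2\pi iz}$, so $\log q=2\pi i z$. The operator $T_p$ is described via Tate curves (Katz): over $\mathbb Z[1/pN,\zeta_p]((q^{1/p}))$, with $\zeta_p$ a primitive $p$-th root of unity, the Tate curve $\mathrm{Tate}(q^N)$ has $p+1$ subgroups of order $p$, namely that generated by $\zeta_p$ and those generated by $(\zeta_p^iq^{1/p})^N$ for $1\le i\le p$. For a form $f$ of weight $k$ with trivial Nebentypus character and $q$-expansion $f(q)$, summing over these subgroups gives $$T_pf(q)=\frac1p\,p^k\Big(f(q^p)+\sum_{i=1}^pp^{-k}f(\zeta_p^iq^{1/p})\Big).$$ ''Extends'' means that the same formula is applied to $\mathcal F=\log q$, where: $\mathcal F$ is regarded as having weight $k=-2$, i.e. $\mathcal F(\mathrm{Tate}(q^N),P_0,p\,\omega_{\mathrm{can}})=p^2\,\mathcal F(\mathrm{Tate}(q^N),P_0,\omega_{\mathrm{can}})$, with $\omega_{\mathrm{can}}$ the canonical differential; and $\log$ is interpreted as the $p$-adic logarithm on constants, so that $\log\zeta_p^i=0$, while $\log(q^p)=p\log q$ and $\log(\zeta_p^iq^{1/p})=\log\zeta_p^i+p^{-1}\log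 q$. *)

(* Defs.v *)
From HB Require Import structures.
From mathcomp Require Import all_boot all_order all_algebra.
From mathcomp Require Import all_classical all_reals.
From mathcomp Require Import zify.

Set Implicit Arguments.
Unset Strict Implicit.
Unset Printing Implicit Defensive.

Import Order.TTheory GRing.Theory Num.Theory.
Local Open Scope ring_scope.

Section Laurent.
Variable R : comNzRingType.
Implicit Types (f g h : int -> R) (a b c : int).

Definition from a f := forall n : int, n < a -> f n = 0.

Definition laurent_pred : {pred int -> R} := fun f => `[< exists a, from a f >].

Lemma laurent_predP f : reflect (exists a, from a f) (f \in laurent_pred).
Proof. exact: asboolP. Qed.

Lemma laurent_zmod_closed : zmod_closed laurent_pred.
Proof.
split; first by apply/laurent_predP; exists 0.
move=> f g /laurent_predP[a fa] /laurent_predP[b gb]; apply/laurent_predP.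
exists (Order.min a b) => n; rewrite lt_min => /andP[na nb].
have -> : (f - g) n = f n - g n by [].
by rewrite fa // gb // subr0.
Qed.

HB.instance Definition _ :=
  GRing.isZmodClosed.Build _ laurent_pred laurent_zmod_closed.

Record laurent := Laurent {lcoef :> int -> R; _ : lcoef \in laurent_pred}.
HB.instance Definition _ := [isSub for lcoef].
HB.instance Definition _ := [Choice of laurent by <:].
HB.instance Definition _ := [SubChoice_isSubZmodule of laurent by <:].

Lemma laurent_from (F : laurent) : exists a, from a F.
Proof. by case: F => f /= /laurent_predP. Qed.

Lemma laurentP (F G : laurent) : (forall n, F n = G n) -> F = G.
Proof. by move=> FG; apply: val_inj; apply/funext. Qed.

(* The sum has finite support when f and g vanish far to the left. *)
Definition lmul_coef f g (n : int) : R :=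
  \sum_(i \in [set: int]) f i * g (n - i).

Let pmul (u v : nat -> R) n := \sum_(i < n.+1) u i * v (n - i)%N.

Let pmulE u v m n : (n < m)%N ->
  pmul u v n = ((\poly_(i < m) u i) * (\poly_(i < m) v i))`_n.
Proof.
move=> nm; rewrite coefM; apply: eq_bigr => i _; rewrite !coef_poly.
have -> : (i < m)%N by apply: leq_ltn_trans nm; rewrite -ltnS.
by have -> : (n - i < m)%N by apply: leq_ltn_trans nm; rewrite leq_subr.
Qed.

Let pmulC u v n : pmul u v n = pmul v u n.
Proof. by rewrite !(@pmulE _ _ n.+1) // mulrC. Qed.

Let pmulA u v w n : pmul u (pmul v w) n = pmul (pmul u v) w n.
Proof.
have E (s t : nat -> R) i : (i < n.+1)%N ->
    (\poly_(i < n.+1) pmul s t i)`_i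
    = (\poly_(i < n.+1) s i * \poly_(i < n.+1) t i)`_i.
  by move=> ltin; rewrite coef_poly ltin (@pmulE _ _ n.+1).
rewrite !(@pmulE _ _ n.+1) //.
transitivity ((\poly_(i < n.+1) u i
   * (\poly_(i < n.+1) v i * \poly_(i < n.+1) w i))`_n).
  by rewrite !coefM; apply: eq_bigr => i _; rewrite E // ltnS leq_subr.
rewrite mulrA !coefM; apply: eq_bigr => i _; rewrite E //.
Qed.

Let sh a f (i : nat) := f (a + i%:Z).

Lemma lmul_coef_from f g a b :
  from a f -> from b g -> from (a + b) (lmul_coef f g).
Proof.
move=> fa gb n nab; rewrite /lmul_coef fsbig1 // => i _.
have [ia|ai] := ltP i a; first by rewrite fa // mul0r.
by rewrite gb ?mulr0 //; lia.
Qed.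

Let lmul_coefE f g a b (n : nat) : from a f -> from b g ->
  lmul_coef f g (a + b + n%:Z) = pmul (sh a f) (sh b g) n.
Proof.
move=> fa gb; rewrite /lmul_coef.
have ur : uniq [seq a + i%:Z | i <- index_iota 0 n.+1].
  by rewrite map_inj_uniq ?iota_uniq // => i j /addrI[].
rewrite (fsbigE _ _ ur) //.
  rewrite big_map big_mkord; apply: eq_big => [i|i _]; first by rewrite in_setT.
  by rewrite /sh; congr (_ * g _); have := ltn_ord i; lia.
move=> i _ /mapP nr; have [ia|ai] := ltP i a; first by rewrite fa // mul0r.
have [ni|ni] := ltP (a + n%:Z) i; first by rewrite [X in _ * X]gb ?mulr0 //; lia.
by case: nr; exists `|i - a|%N; rewrite ?mem_index_iota; lia.
Qed.

Lemma lmul_subproof (F G : laurent) : lmul_coef F G \in laurent_pred.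
Proof.
have [[a Fa] [b Gb]] := (laurent_from F, laurent_from G).
by apply/laurent_predP; exists (a + b); exact: lmul_coef_from.
Qed.

Definition lmul (F G : laurent) := Laurent (lmul_subproof F G).

Lemma monomial_subproof (v : R) (m : int) :
  (fun n : int => if n == m then v else 0) \in laurent_pred.
Proof. by apply/laurent_predP; exists m => n nm; case: eqP => //; lia. Qed.

Definition monomial (v : R) (m : int) : laurent := Laurent (monomial_subproof v m).

Definition lconst (v : R) : laurent := monomial v 0.

Let from_eq a n f g : from a f -> from a g ->
  (forall k : nat, f (a + k%:Z) = g (a + k%:Z)) -> f n = g n.
Proof.
move=> fa ga fg; have [na|an] := ltP n a; first by rewrite fa ?ga.
have -> : n = a + `|n - a|%N%:Z by lia.
exact: fg.
Qed.

Let lmulC : commutative lmul.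
Proof.
move=> F G; apply: laurentP => n /=.
have [[a Fa] [b Gb]] := (laurent_from F, laurent_from G).
apply: (@from_eq (a + b)); first exact: lmul_coef_from.
  by rewrite addrC; exact: lmul_coef_from.
by move=> k; rewrite lmul_coefE // pmulC -lmul_coefE // (addrC a).
Qed.

Let lmulA : associative lmul.
Proof.
move=> F G H; apply: laurentP => n /=.
have [[[a Fa] [b Gb]] [c Hc]] := (laurent_from F, laurent_from G, laurent_from H).
have FG := lmul_coef_from Fa Gb; have GH := lmul_coef_from Gb Hc.
apply: (@from_eq (a + b + c)); last 1 first.
- move=> k; rewrite (lmul_coefE _ FG Hc) -(addrA a) (lmul_coefE _ Fa GH).
  transitivity (pmul (sh a F) (pmul (sh b G) (sh c H)) k).
    by apply: eq_bigr => i _; congr (_ * _); rewrite /sh lmul_coefE.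
  rewrite pmulA; apply: eq_bigr => i _; congr (_ * _).
  by rewrite /sh lmul_coefE.
- by rewrite -addrA; exact: lmul_coef_from.
- exact: lmul_coef_from.
Qed.

Let lmul1 : left_id (lconst 1) lmul.
Proof.
move=> F; apply: laurentP => n /=; rewrite /lmul_coef.
rewrite (fsbigE [:: 0 : int]) //=.
  by rewrite big_cons big_nil in_setT mul1r subr0 addr0.
by move=> i _; rewrite inE; case: eqP => // _ _; rewrite mul0r.
Qed.

Let lmulDl : left_distributive lmul +%R.
Proof.
move=> F G H; apply: laurentP => n /=.
have [[[a Fa] [b Gb]] [c Hc]] := (laurent_from F, laurent_from G, laurent_from H).
pose m := Order.min a b.
have Fm : from m F by move=> i im; apply: Fa; move: im; rewrite /m; lia.
have Gm : from m G by move=> i im; apply: Gb; move: im; rewrite /m; lia.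
have FGm : from m (fun i => F i + G i).
  by move=> i im; rewrite Fm // Gm // addr0.
change (lmul_coef (fun i => F i + G i) H n
  = (fun i => lmul_coef F H i + lmul_coef G H i) n).
apply: (@from_eq (m + c)); first exact: lmul_coef_from.
  by move=> i im; rewrite !(@lmul_coef_from _ _ m c) // addr0.
move=> k; rewrite !lmul_coefE // -big_split /=.
by apply: eq_bigr => i _; rewrite -mulrDl.
Qed.

Let lone_neq0 : lconst 1 != 0.
Proof.
apply/eqP => /(congr1 (fun F : laurent => F 0)) /= /eqP.
by rewrite oner_eq0.
Qed.

HB.instance Definition _ := GRing.Zmodule_isComNzRing.Build laurent
  lmulA lmulC lmul1 lmulDl lone_neq0.

End Laurent.

Section LaurentConstructions.
Variable R : comNzRingType.

Lemma power_series_subproof (u : nat -> int) :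
  (fun n : int => if n is Posz k then (u k)%:~R : R else 0) \in @laurent_pred R.
Proof. by apply/laurent_predP; exists 0 => -[]. Qed.

Definition power_series (u : nat -> int) : laurent R :=
  Laurent (power_series_subproof u).

Lemma lmap_subproof (S : comNzRingType) (phi : S -> R) (F : laurent S) :
  (fun n : int => if F n == 0 then 0 else phi (F n)) \in @laurent_pred R.
Proof.
have [a Fa] := laurent_from F; apply/laurent_predP; exists a => n na.
by rewrite Fa // eqxx.
Qed.

(* Coefficientwise image. Testing F n == 0 keeps the support bounded below for
   an arbitrary map phi; the test is redundant when phi 0 = 0. *)
Definition lmap (S : comNzRingType) (phi : S -> R) (F : laurent S) : laurent R :=
  Laurent (lmap_subproof phi F).

End LaurentConstructions.

Section Substitution.
Variable K : fieldType.

Lemma lsubst_subproof (c : K) (m : nat) (F : laurent K) :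
  (fun n : int => if (m %| n)%Z then F (n %/ m)%Z * c ^ (n %/ m)%Z else 0)
    \in @laurent_pred K.
Proof.
have [a Fa] := laurent_from F; apply/laurent_predP.
exists (Order.min 0 (m%:Z * a)) => n; rewrite lt_min => /andP[n0 nma].
case: ifP => // /dvdzP[d nE]; rewrite nE in n0 nma *.
have m0 : m%:Z != 0 by case: eqP n0 => // ->; rewrite mulr0.
by rewrite mulzK // Fa ?mul0r //; nia.
Qed.

(* F(q) |-> F(c t^m), for c != 0 and m > 0 *)
Definition lsubst (c : K) (m : nat) (F : laurent K) : laurent K :=
  Laurent (lsubst_subproof c m F).

End Substitution.

Section Localization.
Variable N : nat.

Definition zloc_pred : {pred rat} :=
  fun x => `[< exists e : nat, x * N%:R ^+ e \is a Num.int >].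

Lemma zloc_subring_closed : subring_closed zloc_pred.
Proof.
split; first by apply/asboolP; exists 0%N; rewrite mulr1.
- move=> x y /asboolP[d xd] /asboolP[e ye]; apply/asboolP; exists (d + e)%N.
  rewrite mulrBl {1}exprD addnC exprD !mulrA.
  by rewrite rpredB // rpredM // rpredX // natr_int.
- move=> x y /asboolP[d xd] /asboolP[e ye]; apply/asboolP; exists (d + e)%N.
  by rewrite exprD mulrACA rpredM.
Qed.

HB.instance Definition _ :=
  GRing.isSubringClosed.Build _ zloc_pred zloc_subring_closed.

Record zloc := Zloc {zloc_val :> rat; _ : zloc_val \in zloc_pred}.
HB.instance Definition _ := [isSub for zloc_val].
HB.instance Definition _ := [Choice of zloc by <:].
HB.instance Definition _ := [SubChoice_isSubComNzRing of zloc by <:].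

End Localization.

(* An elliptic curve E over R with a nowhere vanishing invariant differential w
   admits a global equation
     y^2 + a1 x y + a3 y = x^3 + a2 x^2 + a4 x + a6,  w = dx/(2y + a1 x + a3),
   and (E, w) is represented by its coefficients. *)
Record weierstrass (R : Type) := Weierstrass {
  wa1 : R; wa2 : R; wa3 : R; wa4 : R; wa6 : R }.

Definition map_weierstrass (R S : Type) (phi : R -> S) (W : weierstrass R) :=
  Weierstrass (phi (wa1 W)) (phi (wa2 W)) (phi (wa3 W)) (phi (wa4 W))
    (phi (wa6 W)).

Definition map_point (R S : Type) (phi : R -> S) (P : R * R) :=
  (phi P.1, phi P.2).

Definition invertible (R : comNzRingType) (u : R) := exists v, u * v = 1.

Section Weierstrass.
Variables (R : comNzRingType) (W : weierstrass R).
Implicit Types P Q S : R * R.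

Definition discriminant : R :=
  let: Weierstrass a1 a2 a3 a4 a6 := W in
  let b2 := a1 ^+ 2 + 4 * a2 in
  let b4 := 2 * a4 + a1 * a3 in
  let b6 := a3 ^+ 2 + 4 * a6 in
  let b8 := a1 ^+ 2 * a6 + 4 * a2 * a6 - a1 * a3 * a4 + a2 * a3 ^+ 2 - a4 ^+ 2 in
  - b2 ^+ 2 * b8 - 8 * b4 ^+ 3 - 27 * b6 ^+ 2 + 9 * b2 * b4 * b6.

Definition on_curve P :=
  let: Weierstrass a1 a2 a3 a4 a6 := W in
  P.2 ^+ 2 + a1 * P.1 * P.2 + a3 * P.2
  = P.1 ^+ 3 + a2 * P.1 ^+ 2 + a4 * P.1 + a6.

Definition wopp P : R * R := (P.1, - P.2 - wa1 W * P.1 - wa3 W).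

(* the sum of P and Q when the line joining them has slope l *)
Definition wsum (l : R) P Q : R * R :=
  let x := l ^+ 2 + wa1 W * l - wa2 W - P.1 - Q.1 in
  wopp (x, l * (x - P.1) + P.2).

(* S = P + Q, where P - Q and P + Q are nonzero in every fibre *)
Definition is_chord_sum P Q S := exists l v,
  [/\ (Q.1 - P.1) * v = 1, l = (Q.2 - P.2) * v & S = wsum l P Q].

(* S = P + P, where 2P is nonzero in every fibre *)
Definition is_double P S := exists l v,
  [/\ (2 * P.2 + wa1 W * P.1 + wa3 W) * v = 1,
      l = (3 * P.1 ^+ 2 + 2 * wa2 W * P.1 + wa4 W - wa1 W * P.2) * v
    & S = wsum l P P].

(* The affine point P has exact order N (that is, NP = 0 and jP is nonzero in
   every fibre for 0 < j < N) and M j = jP for 0 < j < N. Under this condition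
   the denominators in P + P and in jP + P, 1 < j < N - 1, are units of R, so
   that the chord-tangent law makes sense over R; NP = 0 is (N-1)P = -P. *)
Definition multiples (N : nat) P (M : nat -> R * R) :=
  [/\ M 1%N = P, is_double P (M 2),
      forall j, (1 < j < N.-1)%N -> is_chord_sum P (M j) (M j.+1)
    & M N.-1 = wopp P].

Definition exact_order (N : nat) P := exists M, multiples N P M.

(* Z[1/N]-algebra R, elliptic curve over R, point of exact order N *)
Definition level_structure (N : nat) P :=
  [/\ invertible (N%:R : R), invertible discriminant, on_curve P
    & exact_order N P].

(* The substitution x = u^2 x' + r, y = u^3 y' + s u^2 x' + t, with v = u^-1.
   It maps (E, w) to an equation of (E, u w). *)
Definition change_weierstrass (v r s t : R) : weierstrass R :=
  let: Weierstrass a1 a2 a3 a4 a6 := W in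
  Weierstrass
    (v * (a1 + 2 * s))
    (v ^+ 2 * (a2 - s * a1 + 3 * r - s ^+ 2))
    (v ^+ 3 * (a3 + r * a1 + 2 * t))
    (v ^+ 4 * (a4 - s * a3 + 2 * r * a2 - (t + r * s) * a1 + 3 * r ^+ 2
               - 2 * s * t))
    (v ^+ 6 * (a6 + r * a4 + r ^+ 2 * a2 + r ^+ 3 - t * a3 - t ^+ 2
               - r * t * a1)).

Definition change_point (v r s t : R) P : R * R :=
  (v ^+ 2 * (P.1 - r), v ^+ 3 * (P.2 - s * (P.1 - r) - t)).

End Weierstrass.

(* A value for each test object (E, P, w). Values outside of the test objects
   singled out by level_structure are irrelevant. *)
Definition rule := forall R : comNzRingType, weierstrass R -> R * R -> R.

(* u^k, where v = u^-1 *)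
Definition unit_pow (R : comNzRingType) (u v : R) (k : int) : R :=
  match k with Posz n => u ^+ n | Negz n => v ^+ n.+1 end.

(* No condition at the cusps. *)
Record modular_form_Gamma1 (N : nat) (k : int) (f : rule) : Prop := {
  base_change : forall (R S : comNzRingType) (phi : {rmorphism R -> S})
      (W : weierstrass R) (P : R * R), level_structure W N P ->
    f S (map_weierstrass phi W) (map_point phi P) = phi (f R W P);
  (* f(E, P, u w) = u^-k f(E, P, w) and independence of the equation *)
  homogeneous : forall (R : comNzRingType) (u v r s t : R)
      (W : weierstrass R) (P : R * R), level_structure W N P -> u * v = 1 ->
    f R (change_weierstrass W v r s t) (change_point v r s t P)
      = unit_pow v u k * f R W P }.

(* f(E, dP, w) = f(E, P, w) for d prime to N *)
Definition trivial_nebentypus (N : nat) (f : rule) :=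
  forall (R : comNzRingType) (W : weierstrass R) (P : R * R)
    (M : nat -> R * R) (d : nat),
  level_structure W N P -> multiples W N P M -> (0 < d < N)%N -> coprime d N ->
  f R W (M d) = f R W P.

Definition modular_form_Gamma0 (N : nat) (k : int) (f : rule) :=
  modular_form_Gamma1 N k f /\ trivial_nebentypus N f.

Section Tate.
Variables (R : comNzRingType) (N : nat).

(* coefficient of q^n in sum_(m >= 1) sigma_k(m) q^(N m) *)
Definition sigmaN (k n : nat) : nat :=
  if (N %| n)%N then \sum_(1 <= d < (n %/ N).+1 | (d %| n %/ N)%N) (d ^ k)%N
  else 0%N.

(* y^2 + x y = x^3 + a4 x + a6 with a4 = -5 s_3(q^N) and
   a6 = -(5 s_3(q^N) + 7 s_5(q^N))/12 (an exact division); the differential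
   dx/(2y + x) is the canonical one, du/u on G_m. *)
Definition Tate : weierstrass (laurent R) :=
  Weierstrass 1 0 0
    (power_series R (fun n => - (5 * sigmaN 3 n)%N%:Z))
    (power_series R (fun n => - ((5 * sigmaN 3 n + 7 * sigmaN 5 n) %/ 12)%N%:Z)).

(* The point P_0 of order N of Tate(q^N) = G_m/q^(N Z) given by u = q. With
   Q = q^N, its coordinates are
     x = sum_(n in Z) Q^n u/(1 - Q^n u)^2 - 2 sum_(n >= 1) Q^n/(1 - Q^n)^2,
     y = sum_(n in Z) (Q^n u)^2/(1 - Q^n u)^3 + sum_(n >= 1) Q^n/(1 - Q^n)^2,
   expanded for u = q; n <= -1 is rewritten in terms of (Q^n u)^-1. *)
Definition tate_x (n : nat) : int :=
  \sum_(1 <= m < n.+1 | (m %| n)%N) let e := ((n %/ m) %% N)%N in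
    m%:Z * ((e == 1)%N%:Z + (e == N.-1)%N%:Z - 2 * (e == 0)%N%:Z).

Definition tate_y (n : nat) : int :=
  \sum_(1 <= m < n.+1 | (m %| n)%N) let e := ((n %/ m) %% N)%N in
    'C(m, 2)%:Z * (e == 1)%N%:Z - 'C(m.+1, 2)%:Z * (e == N.-1)%N%:Z
    + m%:Z * (e == 0)%N%:Z.

Definition Tate_point : laurent R * laurent R :=
  (power_series R tate_x, power_series R tate_y).

End Tate.

(* f(q) = f(Tate(q^N), P_0, w_can) in Z[1/N]((q)) *)
Definition q_expansion (N : nat) (f : rule) : laurent (zloc N) :=
  f (laurent (zloc N)) (Tate (zloc N) N) (Tate_point (zloc N) N).

(* K is a field of characteristic 0, complete for an absolute value extending
   the normalized p-adic one. *)
Record padic_field (R : realType) (p : nat) (K : fieldType) (v : K -> R) : Prop := {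
  padic_ge0 : forall x, 0 <= v x;
  padic_eq0 : forall x, v x = 0 -> x = 0;
  padicM : forall x y, v (x * y) = v x * v y;
  padicD : forall x y, v (x + y) <= Num.max (v x) (v y);
  padic_p : v p%:R = p%:R^-1;
  padic_complete : forall u : nat -> K,
    (forall e, 0 < e -> exists n0, forall m n, (n0 <= m)%N -> (n0 <= n)%N ->
       v (u m - u n) < e) ->
    exists l, forall e, 0 < e -> exists n0, forall n, (n0 <= n)%N -> v (u n - l) < e }.

Section Logarithm.
Variables (R : realType) (K : fieldType) (v : K -> R).

Definition vcvg (u : nat -> K) (l : K) :=
  forall e, 0 < e -> exists n0, forall n, (n0 <= n)%N -> v (u n - l) < e.

(* The sum of (-1)^(n+1) (c - 1)^n / n over n >= 1. The series converges if and
   only if v (c - 1) < 1; otherwise plog c = 0 is a dummy value. *)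
Definition plog (c : K) : K :=
  xget 0 [set l | vcvg (fun M : nat =>
    \sum_(1 <= n < M.+1) (-1) ^+ n.+1 * (c - 1) ^+ n / n%:R) l].

End Logarithm.

Section Hecke.
Variables (R : realType) (p : nat) (K : fieldType) (v : K -> R) (zeta : K).

(* The image in K((q)) of the q-expansion of a form over Z[1/N] *)
Definition q_expansion_in (N : nat) (f : rule) : laurent K :=
  lmap (fun a : zloc N => ratr (val a) : K) (q_expansion N f).

(* K((q^(1/p))) is laurent K in the variable t = q^(1/p). Hence f(q^p) is
   f(t^(p^2)), f(zeta^i q^(1/p)) is f(zeta^i t), and K((q)) is contained in
   K((q^(1/p))) by q |-> t^p. *)
Definition hecke (k : int) (f : laurent K) : laurent K :=
  lconst (p%:R^-1 * p%:R ^ k) *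
  (lsubst 1 (p ^ 2) f
   + \sum_(1 <= i < p.+1) lconst (p%:R ^ (- k)) * lsubst (zeta ^+ i) 1 f).

(* log q is the indeterminate both of K((q))[log q] and of
   K((q^(1/p)))[log q]. *)
Definition log_q : {poly laurent K} := 'X.

(* log (c t^m) = log c + (m/p) log q, with log c the p-adic logarithm *)
Definition log_monomial (c : K) (m : nat) : {poly laurent K} :=
  (lconst (plog v c))%:P + lconst (m%:R / p%:R) *: log_q.

(* F(q, log q) |-> F(c t^m, log (c t^m)) *)
Definition log_subst (c : K) (m : nat) (F : {poly laurent K}) : {poly laurent K} :=
  \sum_(j < size F) (lsubst c m F`_j)%:P * log_monomial c m ^+ j.

(* the inclusion of K((q))[log q] in K((q^(1/p)))[log q] *)
Definition log_incl : {poly laurent K} -> {poly laurent K} := log_subst 1 p.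

(* the formula of hecke, applied to an element of K((q))[log q] *)
Definition hecke_log (k : int) (F : {poly laurent K}) : {poly laurent K} :=
  lconst (p%:R^-1 * p%:R ^ k) *:
  (log_subst 1 (p ^ 2) F
   + \sum_(1 <= i < p.+1) lconst (p%:R ^ (- k)) *: log_subst (zeta ^+ i) 1 F).

End Hecke.

(* Main.v *)
Require Import Defs.
From mathcomp Require Import all_boot all_order all_algebra.
From mathcomp Require Import all_classical all_reals.
From mathcomp Require Import ring lra.

Set Implicit Arguments.
Unset Strict Implicit.
Unset Printing Implicit Defensive.

Import Order.TTheory GRing.Theory Num.Theory.
Local Open Scope ring_scope.

(* On K((q))[log q] the formula is an explicit computation with the monomials
   log (c t^m) = log c + (m/p) log q, once log c = 0 is known for c^p = 1.
   For this, write S_M for the truncated logarithm series. The derivative of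
   p S_M(X) - S_M((1 + X)^p - 1) has integer coefficients and is divisible by
   X^M. Integrating, the coefficients vanish up to degree M and the one of X^k
   has absolute value at most 1/|k| <= k, so that |p S_M(c - 1)| is at most the
   supremum of k |c - 1|^k over k > M, which tends to 0. *)

(** * An elementary limit *)

(** With s the square root of r, k s^k (1 - s) is at most (1 - s) times the sum of s^i over i < k,
    hence at most 1. Squaring gives k^2 r^k (1 - s)^2 <= 1, so any k > 1/(e (1 - s)^2) will do. *)
Lemma natmul_expr_small (R : realType) (r e : R) : 0 <= r < 1 -> 0 < e ->
  exists n0, forall k, (n0 <= k)%N -> k%:R * r ^+ k < e.
Proof.
move=> /andP[r0 r1] e0; pose s := Num.sqrt r.
have s0 : 0 <= s by exact: sqrtr_ge0.
have s1 : 0 < 1 - s by rewrite subr_gt0 -sqrtr1 ltr_sqrt.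
have rs : r = s * s by rewrite -expr2 sqr_sqrtr.
have bnd k : k%:R * s ^+ k * (1 - s) <= 1.
  have -> : k%:R * s ^+ k = \sum_(i < k) s ^+ k.
    by rewrite sumr_const card_ord mulr_natl.
  apply: (@le_trans _ _ ((\sum_(i < k) s ^+ i) * (1 - s))).
    rewrite ler_pM2r //; apply: ler_sum => i _.
    by apply: ler_wiXn2l; rewrite // ?(ltnW (ltn_ord i)) // -subr_ge0 ltW.
  rewrite mulrC -opprB mulNr -subrX1 opprB lerBlDr lerDl.
  exact: exprn_ge0.
have d0 : 0 < e * (1 - s) ^+ 2 by rewrite mulr_gt0 ?exprn_gt0.
pose n0 := (Num.bound (e * (1 - s) ^+ 2)^-1).+1.
exists n0 => k kn0.
have k0 : 0 < k%:R :> R by rewrite ltr0n; apply: leq_trans kn0.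
have kd : 1 < k%:R * (e * (1 - s) ^+ 2).
  rewrite -ltr_pdivrMr // div1r.
  apply: lt_le_trans (archi_boundP _) _; first by rewrite invr_ge0 ltW.
  by rewrite ler_nat ltnW.
rewrite -(ltr_pM2l k0) -(@ltr_pM2r _ ((1 - s) ^+ 2)) ?exprn_gt0 //.
apply: le_lt_trans (_ : _ <= 1) _; last by rewrite -mulrA.
have -> : k%:R * (k%:R * r ^+ k) * (1 - s) ^+ 2 = (k%:R * s ^+ k * (1 - s)) ^+ 2.
  rewrite rs exprMn; ring.
rewrite expr_le1 //.
by rewrite !mulr_ge0 ?exprn_ge0 // ltW.
Qed.

(** * The derivative of the logarithm defect, over the integers *)

(** This is the derivative of the truncated series S_M of log(1 + X). Working over [int] makes the
    integrality of the coefficients automatic. *)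
Definition neg_geometric (M : nat) : {poly int} := \sum_(i < M) (- 'X) ^+ i.

Definition log_defect_deriv (p M : nat) : {poly int} :=
  p%:R * neg_geometric M
  - (neg_geometric M \Po ((1 + 'X) ^+ p - 1)) * ((1 + 'X) ^+ p - 1)^`().

Lemma neg_geometricE M : (1 + 'X) * neg_geometric M = 1 - (- 'X) ^+ M.
Proof. by rewrite -opprB subrX1 /neg_geometric -mulNr opprB opprK addrC. Qed.

(** With Y = (1 + X)^p - 1 one has (1 + X) Y' = p (1 + Y), so both geometric sums telescope and
    leave p ((-Y)^M - (-X)^M); moreover X divides Y. *)
Lemma log_defect_derivE p M : (0 < p)%N ->
  exists H, (1 + 'X) * log_defect_deriv p M = 'X^M * H.
Proof.
move=> p0; set Y : {poly int} := (1 + 'X) ^+ p - 1.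
have Y' : Y^`() = p%:R * (1 + 'X) ^+ p.-1.
  by rewrite derivB deriv_exp derivD derivX -polyC1 derivC add0r subr0 mul1r mulr_natl.
have gY : (1 + Y) * (neg_geometric M \Po Y) = 1 - (- Y) ^+ M.
  have := congr1 (comp_poly Y) (neg_geometricE M).
  by rewrite rmorphM rmorphB rmorphD rmorphXn rmorphN !rmorph1 /= comp_polyX.
have YX : Y = 'X * \sum_(i < p) (1 + 'X) ^+ i.
  by rewrite /Y subrX1 [1 + 'X]addrC addrK.
exists (p%:R * ((- \sum_(i < p) (1 + 'X) ^+ i) ^+ M - (-1) ^+ M)).
have -> : (1 + 'X) * log_defect_deriv p M
  = p%:R * ((- Y) ^+ M - (- 'X) ^+ M).
  have -> : (1 + 'X) * log_defect_deriv p M = p%:R * ((1 + 'X) * neg_geometric M)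
      - p%:R * ((1 + 'X) ^+ p * (neg_geometric M \Po Y)).
    rewrite /log_defect_deriv -/Y Y' [(1 + 'X) ^+ p](_ : _ = (1 + 'X) * (1 + 'X) ^+ p.-1);
      last by rewrite -exprS prednK.
    ring.
  have {1}-> : (1 + 'X) ^+ p = 1 + Y by rewrite /Y [RHS]addrC subrK.
  rewrite neg_geometricE gY; ring.
rewrite YX -mulrN exprMn [(- 'X) ^+ M]exprNn; ring.
Qed.

(** The factor 1 + X is a unit among power series: each coefficient of the product is the sum of two
    consecutive ones, so vanishing propagates upwards from degree 0. *)
Lemma log_defect_deriv_coef0 p M k : (0 < p)%N -> (k < M)%N ->
  (log_defect_deriv p M)`_k = 0.
Proof.
move=> p0; have [H E] := log_defect_derivE M p0.
have C i : (i < M)%N -> ((1 + 'X) * log_defect_deriv p M)`_i = 0.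
  by move=> iM; rewrite E coefXnM iM.
elim: k => [|k IH] kM; have := C _ kM; rewrite mulrDl mul1r coefD coefXM /=.
  by rewrite addr0.
by rewrite IH ?addr0 // ltnW.
Qed.

(** * The p-adic absolute value of integers *)

Section Valuation.
Variables (p : nat) (R : realType) (K : fieldType) (v : K -> R).
Hypotheses (hp : prime p) (hK : padic_field p v).

Let vM := padicM hK.
Let vD := padicD hK.

Lemma val_p_gt0 : 0 < v p%:R.
Proof. by rewrite (padic_p hK) invr_gt0 ltr0n prime_gt0. Qed.

Lemma val_p_lt1 : v p%:R < 1.
Proof. by rewrite (padic_p hK) invf_lt1 ?ltr1n ?ltr0n ?prime_gt1 ?prime_gt0. Qed.

Lemma val0 : v 0 = 0.
Proof.
have := vM p%:R 0; rewrite mulr0 => E.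
by have := val_p_lt1; have := padic_ge0 hK 0; nra.
Qed.

Lemma val1 : v 1 = 1.
Proof.
have := vM p%:R 1; rewrite mulr1 => E.
by have := val_p_gt0; nra.
Qed.

Lemma val_neq0 x : x != 0 -> 0 < v x.
Proof.
move=> x0; rewrite lt0r (padic_ge0 hK) andbT.
by apply: contra x0 => /eqP/(padic_eq0 hK)->.
Qed.

Lemma valX x n : v (x ^+ n) = v x ^+ n.
Proof. by elim: n => [|n IH]; rewrite ?val1 // !exprS vM IH. Qed.

Lemma valN x : v (- x) = v x.
Proof.
have v0 := padic_ge0 hK (-1).
have : v (-1) ^+ 2 = 1 by rewrite -valX sqrrN expr1n val1.
move=> /eqP; rewrite sqrf_eq1 => /orP[] /eqP v1; last by lra.
by rewrite -mulN1r vM v1 mul1r.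
Qed.

Lemma val_sum (I : Type) (r : seq I) (P : pred I) (F : I -> K) (e : R) :
  0 <= e -> (forall i, P i -> v (F i) <= e) -> v (\sum_(i <- r | P i) F i) <= e.
Proof.
move=> e0 Fe; elim/big_rec: _ => [|i x Pi xe]; first by rewrite val0.
by apply: le_trans (vD _ _) _; rewrite ge_max Fe.
Qed.

Lemma val_nat_le1 n : v n%:R <= 1.
Proof.
elim: n => [|n IH]; first by rewrite val0.
by rewrite -natr1; apply: le_trans (vD _ _) _; rewrite ge_max IH val1 /=.
Qed.

Lemma val_int_le1 (z : int) : v z%:~R <= 1.
Proof. by case: z => n; rewrite ?NegzE ?mulrNz ?valN; exact: val_nat_le1. Qed.

(** Write 1 = a m - b p by Bezout. Since |b p| < 1, the ultrametric inequality forces 1 <= |a m| <=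
    |m|. *)
Lemma val_coprime m : coprime m p -> v m%:R = 1.
Proof.
move=> mp; have m0 : (0 < m)%N.
  by case: m mp => //; rewrite /coprime gcd0n => /eqP p1; move: hp; rewrite p1.
apply/eqP; rewrite eq_le val_nat_le1 /=.
case: (egcdnP p m0) => a b E _; move: E; rewrite (eqP mp) => E.
have {E} : (1 : K) = (a%:R * m%:R) + - (b%:R * p%:R).
  by rewrite -!natrM E natrD addrAC subrr add0r.
move=> /(congr1 v); rewrite val1 => E.
have := vD (a%:R * m%:R) (- (b%:R * p%:R)).
rewrite -E le_max valN !vM => /orP[] H.
  by apply: le_trans H _; rewrite ler_piMl ?val_nat_le1 // (padic_ge0 hK).
have := val_nat_le1 b; have := padic_ge0 hK b%:R.
have := val_p_gt0; have := val_p_lt1; nra.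
Qed.

(** If p^e is the exact power of p in n, then |n| = p^-e and p^e <= n. *)
Lemma val_nat_ge n : (0 < n)%N -> n%:R^-1 <= v n%:R.
Proof.
move=> n0; have [m /= pm nE] := pfactor_coprime hp n0.
rewrite {2}nE natrM vM val_coprime ?mul1r //; last by rewrite coprime_sym.
rewrite natrX valX (padic_p hK) exprVn -natrX lef_pV2 ?posrE ?ltr0n ?expn_gt0 ?(prime_gt0 hp) //.
by rewrite ler_nat dvdn_leq // pfactor_dvdnn.
Qed.

Lemma padic_natr_neq0 n : (0 < n)%N -> n%:R != 0 :> K.
Proof.
move=> n0; apply/eqP => E; have := val_nat_ge n0.
by rewrite E val0 invr_le0 leNgt ltr0n n0.
Qed.

(** * The p-adic logarithm of p-th roots of unity *)

Definition log_poly (M : nat) : {poly K} :=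
  \sum_(1 <= n < M.+1) ((-1) ^+ n.+1 / n%:R) *: 'X^n.

Lemma horner_log_poly M x :
  (log_poly M).[x] = \sum_(1 <= n < M.+1) (-1) ^+ n.+1 * x ^+ n / n%:R.
Proof.
rewrite horner_sum; apply: eq_bigr => n _.
by rewrite hornerZ hornerXn mulrAC.
Qed.

Lemma log_poly_at0 M : (log_poly M).[0] = 0.
Proof.
rewrite horner_log_poly big_nat big1 // => n /andP[n0 _].
by rewrite expr0n eqn0Ngt n0 mulr0 mul0r.
Qed.

Lemma deriv_log_poly M : (log_poly M)^`() = map_poly intr (neg_geometric M).
Proof.
rewrite /log_poly /neg_geometric raddf_sum rmorph_sum /= big_add1 big_mkord.
apply: eq_bigr => i _; rewrite derivZ derivXn /= rmorphXn rmorphN /= map_polyX.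
rewrite -scaler_nat scalerA divfK ?padic_natr_neq0 // !exprS mulrA mulrNN !mul1r.
by rewrite [RHS]exprNn -signr_odd scaler_sign -[in RHS]signr_odd mulr_sign.
Qed.

Lemma deriv_log_defect M :
  (p%:R * log_poly M - (log_poly M \Po ((1 + 'X) ^+ p - 1)))^`()
  = map_poly intr (log_defect_deriv p M).
Proof.
rewrite derivB deriv_comp mulr_natl derivMn !deriv_log_poly.
rewrite /log_defect_deriv rmorphB !rmorphM /= map_comp_poly rmorph_nat mulr_natl.
by rewrite -deriv_map rmorphB rmorphXn rmorphD /= rmorph1 map_polyX.
Qed.

(** At X = c - 1 the term S_M((1 + X)^p - 1) becomes S_M(0) = 0, so p S_M(c - 1) is a value of the
    defect [D], which the ultrametric inequality bounds monomial by monomial. *)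
Lemma val_log_poly_root_unity M (c : K) (e : R) : c ^+ p = 1 -> 0 <= e ->
  (forall k, (M < k)%N -> k%:R * v (c - 1) ^+ k <= e) ->
  v (p%:R * (log_poly M).[c - 1]) <= e.
Proof.
move=> cp e0 He; set D := p%:R * log_poly M
  - (log_poly M \Po ((1 + 'X) ^+ p - 1)).
have Dx x : D.[x] = p%:R * (log_poly M).[x] - (log_poly M).[(1 + x) ^+ p - 1].
  rewrite hornerD hornerN horner_comp hornerM -polyC_natr hornerC.
  by rewrite hornerD hornerN horner_exp hornerD hornerX hornerC.
have D0 : D`_0 = 0.
  by rewrite -horner_coef0 Dx addr0 expr1n subrr log_poly_at0 mulr0 subr0.
have -> : p%:R * (log_poly M).[c - 1] = D.[c - 1].
  by rewrite Dx [1 + _]addrC subrK cp subrr log_poly_at0 subr0.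
have Dk k : D`_k.+1 * k.+1%:R = ((log_defect_deriv p M)`_k)%:~R.
  by rewrite mulr_natr -coef_deriv deriv_log_defect coef_map.
rewrite horner_coef; apply: val_sum => // -[[|k] /= _] _.
  by rewrite D0 mul0r val0.
have k0 : v k.+1%:R != 0 by rewrite gt_eqF // val_neq0 // padic_natr_neq0.
have [kM|Mk] := ltnP k M.
  have /eqP := Dk k; rewrite log_defect_deriv_coef0 ?prime_gt0 //.
  by rewrite mulf_eq0 (negPf (padic_natr_neq0 _)) // orbF => /eqP->; rewrite mul0r val0.
apply: le_trans (He k.+1 _); last by [].
rewrite vM valX ler_wpM2r ?exprn_ge0 ?(padic_ge0 hK) //.
have := val_int_le1 (log_defect_deriv p M)`_k; rewrite -Dk vM.
(* Dividing an integer by k + 1 costs a factor of at most k + 1 in absolute value. *)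
have k1 : 1 <= k.+1%:R * v k.+1%:R.
  by rewrite mulrC -ler_pdivrMr ?ltr0n // div1r val_nat_ge.
move=> h; rewrite -[leLHS]mulr1.
apply: le_trans (_ : v D`_k.+1 * (k.+1%:R * v k.+1%:R) <= _).
  by rewrite ler_wpM2l ?(padic_ge0 hK).
by rewrite mulrCA ler_piMr.
Qed.

(** The terms of a convergent series tend to 0, whereas |x| >= 1 would give |x^n / n| >= 1 for all n
    >= 1, because |n| <= 1. *)
Lemma vcvg_log_series_lt1 x l :
  vcvg v (fun M => \sum_(1 <= n < M.+1) (-1) ^+ n.+1 * x ^+ n / n%:R) l -> v x < 1.
Proof.
move=> /(_ 1 ltr01)[n0 H]; rewrite ltNge; apply/negP => x1.
have : v ((-1) ^+ n0.+2 * x ^+ n0.+1 / n0.+1%:R) < 1.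
  have -> : (-1) ^+ n0.+2 * x ^+ n0.+1 / n0.+1%:R
    = (\sum_(1 <= n < n0.+2) (-1) ^+ n.+1 * x ^+ n / n%:R - l)
      + - (\sum_(1 <= n < n0.+1) (-1) ^+ n.+1 * x ^+ n / n%:R - l).
    by rewrite [in RHS]big_nat_recr //=; ring.
  by apply: le_lt_trans (vD _ _) _; rewrite valN gt_max !H.
rewrite -mulrA vM valX valN val1 expr1n mul1r ltNge => /negP; apply.
rewrite -(@ler_pM2r _ (v n0.+1%:R)) ?val_neq0 ?padic_natr_neq0 //.
rewrite -vM divfK ?padic_natr_neq0 // mul1r valX.
by apply: le_trans (val_nat_le1 _) _; rewrite exprn_ege1.
Qed.

Lemma plog_root_unity (c : K) : c ^+ p = 1 -> plog v c = 0.
Proof.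
(* Without a limit, [plog] takes its default value 0, as claimed; it remains to show that any limit
   l is 0. *)
move=> cp; rewrite /plog; case: xgetP => // l _ cvl.
have c1 := vcvg_log_series_lt1 cvl; apply: (padic_eq0 hK).
apply/eqP; rewrite eq_le (padic_ge0 hK) andbT leNgt; apply/negP => l0.
(* If l were nonzero, |S_M| >= |l| would hold for large M, so that bounding |p S_M| by half of |p|
   |l| is contradictory. *)
have e0 : 0 < v p%:R * v l / 2.
  by rewrite divr_gt0 // mulr_gt0 // val_p_gt0.
have [n1 H1] := cvl _ l0.
have [n2 H2] : exists n0,
    forall k, (n0 <= k)%N -> k%:R * v (c - 1) ^+ k < v p%:R * v l / 2.
  by apply: natmul_expr_small e0; rewrite (padic_ge0 hK).
pose M := maxn n1 n2.
have : v (p%:R * (log_poly M).[c - 1]) <= v p%:R * v l / 2.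
  apply: val_log_poly_root_unity => // [|k Mk]; first exact: ltW.
  by apply/ltW/H2/ltnW; apply: leq_ltn_trans Mk; rewrite leq_maxr.
have := H1 M (leq_maxl _ _); rewrite -horner_log_poly.
set S := (log_poly M).[c - 1] => Sl pS.
have : v l <= Num.max (v S) (v (S - l)).
  by have := vD S (- (S - l)); rewrite valN opprB addrC subrK.
rewrite le_max [v l <= v (S - l)]leNgt Sl orbF => lS.
have := val_p_gt0; move: pS; rewrite vM; nra.
Qed.

End Valuation.

(** * Constants and substitutions in Laurent series *)

Section Laurent.
Variable K : fieldType.

Lemma lconst0 : lconst 0 = 0 :> laurent K.
Proof. by apply: laurentP => n /=; case: eqP. Qed.

Lemma lconstD (a b : K) : lconst (a + b) = lconst a + lconst b.
Proof.
apply: laurentP => n.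
change (lconst (a + b) n = lconst a n + lconst b n).
by rewrite /=; case: eqP; rewrite ?addr0.
Qed.

Lemma lconstM (a b : K) : lconst (a * b) = lconst a * lconst b.
Proof.
apply: laurentP => n.
change ((if n == 0 then a * b else 0) = lmul_coef (lconst a) (lconst b) n).
rewrite /lmul_coef (fsbigE [:: 0 : int]) //=.
  by rewrite big_cons big_nil in_setT subr0 addr0; case: eqP; rewrite ?mulr0.
by move=> i _; rewrite inE; case: eqP => // _ _; rewrite mul0r.
Qed.

Lemma lconst1 : lconst 1 = 1 :> laurent K.
Proof. by []. Qed.

Lemma lsubst0 (c : K) m : lsubst c m 0 = 0.
Proof. by apply: laurentP => n /=; case: ifP; rewrite // mul0r. Qed.

Lemma lsubst_const (c : K) m a : (0 < m)%N -> lsubst c m (lconst a) = lconst a.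
Proof.
move=> m0; apply: laurentP => n /=.
have [->|n0] := eqVneq n 0; first by rewrite dvdz0 div0z eqxx expr0z mulr1.
case: ifP => // /dvdzP[d nE]; move: n0; rewrite nE mulzK ?mulf_eq0 ?negb_or.
  by move=> /andP[/negPf-> _]; rewrite mul0r.
by rewrite -lt0n.
Qed.

Variables (R : realType) (p : nat) (v : K -> R).

Lemma log_subst_polyC c m (F : laurent K) :
  log_subst p v c m F%:P = (lsubst c m F)%:P.
Proof.
(* The sum in [log_subst] runs over the size of the polynomial, which drops when F = 0; that case is
   treated apart. *)
rewrite /log_subst size_polyC; have [->|F0] := eqVneq F 0.
  by rewrite big_ord0 lsubst0 polyC0.
by rewrite big_ord1 coefC expr0 mulr1.
Qed.

Lemma log_substZX c m (F : laurent K) :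
  log_subst p v c m (F *: log_q K) = (lsubst c m F)%:P * log_monomial p v c m.
Proof.
rewrite /log_subst /log_q; have [->|F0] := eqVneq F 0.
  by rewrite scale0r size_poly0 big_ord0 lsubst0 polyC0 mul0r.
rewrite -mul_polyC size_mulX ?polyC_eq0 // size_polyC F0 mul_polyC big_ord_recl big_ord1 !coefZ !coefX /=.
by rewrite mulr0 lsubst0 polyC0 mul0r add0r mulr1 expr1.
Qed.

End Laurent.

(** * The Hecke operator on log q *)

Theorem proposition5p4 (p N : nat) (hp : prime p) (hN : (3 < N)%N)
    (hpN : coprime N p)
    (R : realType) (K : fieldType) (v : K -> R) (hK : padic_field p v)
    (zeta : K) (hzeta : p.-primitive_root zeta) :
  (forall (k : int) (f : rule), modular_form_Gamma0 N k f ->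
     hecke_log p v zeta k (q_expansion_in K N f)%:P
     = (hecke p zeta k (q_expansion_in K N f))%:P)
  /\ hecke_log p v zeta (- 2) (log_q K)
     = log_incl p v (lconst (p%:R ^- 1 + p%:R ^- 2) *: log_q K).
Proof.
split=> [k f _|].
  (* A q-expansion has degree 0 in log q, where [log_subst] is just [lsubst]. *)
  rewrite /hecke_log /hecke log_subst_polyC -mul_polyC polyCM polyCD.
  rewrite rmorph_sum /=; congr (_ * (_ + _)); apply: eq_bigr => i _.
  by rewrite log_subst_polyC polyCM mul_polyC.
have p0 : p%:R != 0 :> K by rewrite (padic_natr_neq0 hp hK) // prime_gt0.
(* The condition on c covers both c = 1 and the powers of [zeta]. *)
have log_monomialE c m : c ^+ p = 1 ->
    log_monomial p v c m = lconst (m%:R / p%:R) *: log_q K.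
  move=> cp.
  by rewrite /log_monomial (plog_root_unity hp hK cp) lconst0 polyC0 add0r.
have log_substE c m a : c ^+ p = 1 -> (0 < m)%N ->
    log_subst p v c m (lconst a *: log_q K) = lconst (a * (m%:R / p%:R)) *: log_q K.
  move=> cp m0; rewrite log_substZX lsubst_const // log_monomialE //.
  by rewrite mul_polyC scalerA -lconstM.
(* The inclusion is the case m = p, where the factor is p/p. *)
rewrite /log_incl /hecke_log log_substE ?expr1n ?prime_gt0 //.
rewrite -[log_q K in LHS]scale1r -lconst1 log_substE ?expr1n ?expn_gt0 ?prime_gt0 //.
(* For k = -2 the weight factor p^-k is p^2, and log(zeta^i t) = p^-1 log q, so the p summands are
   equal. *)
rewrite (eq_bigr (fun=> lconst (p%:R ^ 2 * (1 * (1 / p%:R))) *: log_q K)); last first.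
  move=> i _; rewrite log_substE //; last by rewrite exprAC (prim_expr_order hzeta) expr1n.
  by rewrite scalerA -lconstM opprK.
rewrite sumr_const_nat subn1 /= -scaler_nat.
have -> : (p%:R : laurent K) = lconst p%:R.
  by elim: (p) => [|n IH]; rewrite ?lconst0 // -!natr1 IH lconstD.
rewrite scalerA -scalerDl scalerA -lconstM -lconstD -lconstM.
(* What is left is p^-3 (p + p * p) = p^-2 + p^-1: the subgroup generated by [zeta] gives p^-2, the
   other p subgroups together give p^-1. *)
congr (lconst _ *: _).
rewrite natrX; change (p%:R ^ (- 2)) with ((p%:R : K) ^- 2).
change (p%:R ^ 2) with ((p%:R : K) ^+ 2).
by field.
Qed.
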